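(* Let $m,k,i$ be positive integers with $i<2^m-1$, and let $\delta\in\mathbb{F}_{2^{2m}}$. Then the polynomial $f(x)=x+\left(\mathrm{Tr}_m^{2m}(x)^k+\delta\right)^{i(2^m+1)}$ is an involution over $\mathbb{F}_{2^{2m}}$, i.e. $f(f(x))=x$ for all $x\in\mathbb{F}_{2^{2m}}$.
   Context: $\mathrm{Tr}_m^{2m}(x)=x+x^{2^m}$ is the trace map from $\mathbb{F}_{2^{2m}}$ to $\mathbb{F}_{2^m}$. *)

(* Defs.v *)
From HB Require Import structures.
From mathcomp Require Import all_boot all_order all_algebra all_field.

Set Implicit Arguments.
Unset Strict Implicit.
Unset Printing Implicit Defensive.

Import GRing.Theory.
Local Open Scope ring_scope.

(* On a field with 2 ^ (2 * m) elements this is the trace onto its subfield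
   with 2 ^ m elements.  It is stated over any ring so that it also yields the
   trace polynomial, as [Tr m 'X]. *)
Definition Tr (R : nzRingType) (m : nat) (x : R) : R := x + x ^+ (2 ^ m).

Definition trace_norm_poly (F : finFieldType) (m k i : nat) (delta : F) :
    {poly F} :=
  'X + (Tr m 'X ^+ k + delta%:P) ^+ (i * (2 ^ m + 1)).

Lemma horner_trace_norm_poly (F : finFieldType) (m k i : nat) (delta x : F) :
  (trace_norm_poly m k i delta).[x] =
  x + (Tr m x ^+ k + delta) ^+ (i * (2 ^ m + 1)).
Proof. by rewrite /trace_norm_poly /Tr !hornerE. Qed.

(* Main.v *)
(* Write q = 2 ^ m.  Every norm N = y ^ (q + 1) satisfies N ^ q = N, so
   Tr N = N + N = 0 in characteristic 2.  Hence adding a power of a norm to x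
   does not change Tr x, and a second application of f adds the same element
   again, which cancels the first. *)
Require Import Defs.
From HB Require Import structures.
From mathcomp Require Import all_boot all_order all_algebra all_field.

Set Implicit Arguments.
Unset Strict Implicit.
Unset Printing Implicit Defensive.

Import GRing.Theory.
Local Open Scope ring_scope.

(** Raising to the power q is the Frobenius map iterated m times, hence additive in characteristic
    2. *)
Lemma TrD (R : comNzRingType) (m : nat) (x y : R) :
  2%N \in [pchar R] -> Tr m (x + y) = Tr m x + Tr m y.
Proof.
move=> char2; have pnat_q : [pchar R].-nat (2 ^ m)%N.
  by rewrite (eq_pnat _ (pcharf_eq char2)) pnatX pnat_id.
by rewrite /Tr (exprDn_pchar _ _ pnat_q) addrACA.
Qed.

Lemma Tr_norm_eq0 (F : finFieldType) (m i : nat) (y : F) :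
  2%N \in [pchar F] -> #|F| = (2 ^ (2 * m))%N ->
  Tr m (y ^+ (i * (2 ^ m + 1))) = 0.
Proof.
move=> char2 cardF; suff normK : (y ^+ (2 ^ m + 1)) ^+ (2 ^ m) = y ^+ (2 ^ m + 1).
  (* With N = y ^ (q + 1), swapping exponents gives (N ^ i) ^ q = (N ^ q) ^ i = N ^ i, so the two
     summands of the trace coincide. *)
  by rewrite /Tr mulnC exprM (exprAC _ i) normK addrr_pchar2.
(* As q * q is the order of [F], (y ^ (q + 1)) ^ q = y ^ (q * q) * y ^ q = y * y ^ q. *)
have yqq : y ^+ (2 ^ m * 2 ^ m) = y by rewrite -expnD addnn -mul2n -cardF expf_card.
by rewrite -exprM mulnDl mul1n exprD yqq addn1 exprS.
Qed.

Theorem theorem11 (F : finFieldType) (m k i : nat) (delta : F)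
    (m_gt0 : (0 < m)%N) (k_gt0 : (0 < k)%N) (i_gt0 : (0 < i)%N)
    (i_lt : (i < 2 ^ m - 1)%N) (cardF : #|F| = (2 ^ (2 * m))%N) :
  let f : {poly F} := trace_norm_poly m k i delta in
  forall x : F, f.[f.[x]] = x.
Proof.
move=> f x; have char2 : 2%N \in [pchar F] by apply: card_finPcharP cardF _.
rewrite !horner_trace_norm_poly TrD // Tr_norm_eq0 // addr0.
by rewrite -addrA addrr_pchar2 ?addr0.
Qed.
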